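(* Let $G$ be a finite simple graph, let $\varphi=[v_1v_2][v_3v_4]\cdots[v_{n-1}v_n]$ be a sequence of pivot operations applicable to $G$, and let $S=\sup(\varphi)$. Then for all $x,y\in V(G)$ with $x\neq y$, $$\det\big((G\varphi)|_{\{x,y\}}\big)=\det\big(G|_{S\oplus\{x,y\}}\big).$$ Consequently, $\{x,y\}\in E(G\varphi)$ if and only if this value equals $1$.
   Context: Graphs are finite, simple (undirected, no loops, no parallel edges). For $X\subseteq V(G)$, $G|_X$ denotes the induced subgraph. $\det H$ for a graph $H$ is the determinant of its adjacency matrix computed over $GF(2)$; the determinant of the empty matrix is $1$. $\oplus$ denotes symmetric difference of sets. For a vertex $x$, $N(x)$ is its neighbourhood and $N'(x)=N(x)\cup\{x\}$. Pivot: for an edge $\{u,v\}\in E(G)$, let $V_1=N'(u)\setminus N'(v)$, $V_2=N'(v)\setminus N'(u)$, $V_3=N'(u)\cap N'(v)$; the graph $G[uv]$ is obtained from $G$ by toggling (adding if absent, removing if present) every pair $\{x,y\}$ with $x\in V_i$, $y\in V_j$, $i\neq j$, all other adjacencies unchanged. A sequence $[v_1v_2][v_3v_4]\cdots[v_{n-1}v_n]$ of pivots is applicable to $G$ if each $\{v_i,v_{i+1}\}$ is an edge of the graph obtained by applying the preceding pivots; $G\varphi$ denotes the resulting graph. The support $\sup(\varphi)=\{v_1\}\oplus\{v_2\}\oplus\cdots\oplus\{v_n\}$ is the set of vertices occurring an odd number of times in the sequence. *)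

(* Defs.v *)
From mathcomp Require Import all_boot all_algebra.

Set Implicit Arguments.
Unset Strict Implicit.
Unset Printing Implicit Defensive.

Record sgraph (T : finType) := SGraph {
  edge :> rel T;
  edge_sym : symmetric edge;
  edge_irr : irreflexive edge }.

Section Induced.
Variables (T : finType) (G : sgraph T) (X : {set T}).

Definition induced_rel : rel {x : T | x \in X} :=
  fun x y => G (val x) (val y).

Fact induced_sym : symmetric induced_rel.
Proof. by move=> x y; rewrite /induced_rel edge_sym. Qed.

Fact induced_irr : irreflexive induced_rel.
Proof. by move=> x; rewrite /induced_rel edge_irr. Qed.

Definition induced : sgraph {x : T | x \in X} :=
  SGraph induced_sym induced_irr.

End Induced.

(* Vertices are ordered by the enumeration of the vertex type; the determinant
   does not depend on this choice. *)
Definition adjmx (T : finType) (G : sgraph T) : 'M['F_2]_#|T| :=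
  (\matrix_(i, j) (G (enum_val i) (enum_val j))%:R)%R.

Definition gdet (T : finType) (G : sgraph T) : 'F_2 := (\det (adjmx G))%R.

Definition symdiff (T : finType) (A B : {set T}) : {set T} :=
  (A :\: B) :|: (B :\: A).

Definition nbhd (T : finType) (G : sgraph T) (x : T) : {set T} :=
  [set y | G x y].

Definition cnbhd (T : finType) (G : sgraph T) (x : T) : {set T} :=
  x |: nbhd G x.

Section Pivot.
Variables (T : finType) (G : sgraph T) (u v : T).

Let V1 : {set T} := cnbhd G u :\: cnbhd G v.
Let V2 : {set T} := cnbhd G v :\: cnbhd G u.
Let V3 : {set T} := cnbhd G u :&: cnbhd G v.

Definition between (A B : {set T}) (x y : T) : bool :=
  ((x \in A) && (y \in B)) || ((x \in B) && (y \in A)).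

Definition pivot_toggled (x y : T) : bool :=
  [|| between V1 V2 x y, between V1 V3 x y | between V2 V3 x y].

Definition pivot_rel : rel T := fun x y => G x y (+) pivot_toggled x y.

Fact pivot_sym : symmetric pivot_rel.
Proof.
move=> x y; rewrite /pivot_rel edge_sym /pivot_toggled /between.
by congr (_ (+) [|| _, _ | _]); rewrite orbC; congr (_ || _); rewrite andbC.
Qed.

Fact pivot_irr : irreflexive pivot_rel.
Proof.
move=> x; rewrite /pivot_rel edge_irr /pivot_toggled /between !in_setD in_setI.
by case: (x \in cnbhd G u); case: (x \in cnbhd G v).
Qed.

(* Total in u and v; only meaningful when u v is an edge of G, which is what
   [applicable] requires. *)
Definition pivot : sgraph T := SGraph pivot_sym pivot_irr.

End Pivot.

Fixpoint applicable (T : finType) (G : sgraph T) (phi : seq (T * T)) : bool :=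
  if phi is (u, v) :: phi' then G u v && applicable (pivot G u v) phi'
  else true.

Definition pivots (T : finType) (G : sgraph T) (phi : seq (T * T)) : sgraph T :=
  foldl (fun H p => pivot H p.1 p.2) G phi.

Definition supp (T : finType) (phi : seq (T * T)) : {set T} :=
  \big[@symdiff T/set0]_(p <- phi) symdiff [set p.1] [set p.2].

(* Main.v *)
(* Write G_Y for the matrix whose rows indexed by Y are those of the adjacency
   matrix of G and whose other rows are those of the identity, so that
   det G_Y = det G|_Y. With X = {u, v} an edge of G, pivoting on uv is the
   principal pivot transform on X: it exchanges the coordinates in X of a vector
   with those of its image. Hence G[uv]_Y * G_X = G_(X (+) Y) for every Y; for
   Y = X the right-hand side is the identity, so det G_X = 1 over GF(2), and
   det G[uv]|_Y = det G|_(X (+) Y). Now iterate. *)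
Require Import Defs.
From mathcomp Require Import all_boot all_algebra all_fingroup.

Set Implicit Arguments.
Unset Strict Implicit.
Unset Printing Implicit Defensive.

Import GRing.Theory.
Local Open Scope ring_scope.

(** Indexing entries by [T] itself lets products and case analyses speak of vertices rather than of
    ordinals. *)
Definition fdet (R : comNzRingType) (T : finType) (f : T -> T -> R) : R :=
  \det (\matrix_(i < #|T|, j < #|T|) f (enum_val i) (enum_val j)).

Lemma eq_fdet (R : comNzRingType) (T : finType) (f g : T -> T -> R) :
  f =2 g -> fdet f = fdet g.
Proof. by move=> fg; congr (\det _); apply/matrixP => i j; rewrite !mxE fg. Qed.

Lemma fdetM (R : comNzRingType) (T : finType) (f g : T -> T -> R) :
  fdet f * fdet g = fdet (fun i j => \sum_k f i k * g k j).
Proof.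
rewrite /fdet -det_mulmx; congr (\det _); apply/matrixP => i j.
rewrite !mxE [RHS](reindex (@enum_val T T)) /=; last exact/onW_bij/enum_val_bij.
by apply: eq_bigr => k _; rewrite !mxE.
Qed.

Lemma fdet1 (R : comNzRingType) (T : finType) :
  fdet (fun i j : T => (i == j)%:R : R) = 1.
Proof.
rewrite -[RHS](det1 R #|T|); congr (\det _); apply/matrixP => i j.
by rewrite !mxE (inj_eq enum_val_inj).
Qed.

(** Two enumerations of [T] differ by one permutation acting on both rows and columns, so its sign
    occurs twice and cancels. This allows vertices to be listed in a convenient order. *)
Lemma fdet_reindex (R : comNzRingType) (T : finType) (f : T -> T -> R)
    (m : nat) (e : 'I_m -> T) :
  bijective e -> \det (\matrix_(i, j) f (e i) (e j)) = fdet f.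
Proof.
move=> bij_e; have mT : m = #|T| by rewrite -(bij_eq_card bij_e) card_ord.
subst m; have inj_s : injective (enum_rank \o e).
  exact: inj_comp enum_rank_inj (bij_inj bij_e).
set s := perm inj_s.
have -> : \matrix_(i, j) f (e i) (e j) =
    row_perm s (col_perm s (\matrix_(i, j) f (enum_val i) (enum_val j))).
  by apply/matrixP => i j; rewrite !mxE !permE /= !enum_rankK.
rewrite row_permE col_permE !det_mulmx !det_perm odd_permV mulrC -mulrA.
by rewrite -signr_addb addbb mulr1.
Qed.

(** The matrix $G_Y$ of the overview, one size for all [Y], so that such matrices can be
    multiplied. *)
Definition mixed (T : finType) (G : rel T) (Y : {set T}) (i j : T) : 'F_2 :=
  (if i \in Y then G i j else i == j)%:R.

(** With the vertices of [Y] listed first, $G_Y$ is block upper triangular: its diagonal blocks are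
    the adjacency matrix of the induced graph and an identity. *)
Lemma gdet_induced (T : finType) (G : sgraph T) (Y : {set T}) :
  gdet (induced G Y) = fdet (mixed G Y).
Proof.
pose A : finType := {x : T | x \in Y}; pose B : finType := {x : T | x \notin Y}.
pose e (i : 'I_(#|A| + #|B|)) : T :=
  match split i with
  | inl a => val (enum_val a)
  | inr b => val (enum_val b)
  end.
have inj_e : injective e.
  move=> i j; rewrite /e -{2}(splitK i) -{2}(splitK j).
  case: (split i) (split j) => [a|b] [a'|b'] eq_e.
  - by rewrite (enum_val_inj (val_inj eq_e)).
  - by have := valP (enum_val b'); rewrite -eq_e (valP (enum_val a)).
  - by have := valP (enum_val b); rewrite eq_e (valP (enum_val a')).
  - by rewrite (enum_val_inj (val_inj eq_e)).
have bij_e : bijective e.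
  apply: inj_card_bij inj_e _.
  rewrite card_ord !card_sig -(cardC (mem Y)) leq_eqVlt; apply/orP; left.
  by apply/eqP; congr addn; apply: eq_card => x; rewrite !inE.
rewrite -(fdet_reindex _ bij_e).
pose C : 'M['F_2]_(#|A|, #|B|) :=
  \matrix_(a, b) (G (val (enum_val a)) (val (enum_val b)))%:R.
have -> : \matrix_(i, j) mixed G Y (e i) (e j) =
    block_mx (adjmx (induced G Y)) C 0 1%:M.
  apply/matrixP => i j; rewrite -(splitK i) -(splitK j).
  rewrite mxE /e !unsplitK /mixed.
  case: (split i) (split j) => [a|b] [a'|b'] /=.
  - by rewrite block_mxEul mxE (valP (enum_val a)).
  - by rewrite block_mxEur mxE (valP (enum_val a)).
  - rewrite block_mxEdl mxE (negPf (valP (enum_val b))).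
    case: eqP => // eq_ba; case/negP: (valP (enum_val b)).
    by rewrite /= eq_ba; apply: valP.
  - rewrite block_mxEdr mxE (negPf (valP (enum_val b))).
    by rewrite (inj_eq val_inj) (inj_eq enum_val_inj).
by rewrite det_ublock det1 mulr1.
Qed.

Lemma F2_addb (a b : bool) : (a (+) b)%:R = a%:R + b%:R :> 'F_2.
Proof. by case: a b => [] []; apply: val_inj. Qed.

Lemma F2_andb (a b : bool) : (a && b)%:R = a%:R * b%:R :> 'F_2.
Proof. by case: a b => [] []; apply: val_inj. Qed.

Lemma in_symdiff (T : finType) (A B : {set T}) (x : T) :
  (x \in symdiff A B) = (x \in A) (+) (x \in B).
Proof. by rewrite !inE; case: (x \in A); case: (x \in B). Qed.

(** For $X = \{u,v\}$, the left side is entry $(i,j)$ of the adjacency matrix of $G[uv]$ times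
    $G_X$: the terms come from $k = u$, $k = v$ and, when $j \notin X$, $k = j$. *)
Lemma pivot_exchange (T : finType) (G : sgraph T) (u v i j : T) :
  G u v ->
  (pivot G u v i u && G u j)
    (+) (pivot G u v i v && G v j)
    (+) ((j \notin [set u; v]) && pivot G u v i j)
  = (if i \in [set u; v] then i == j else G i j).
Proof.
move=> uv; have vu : G v u by rewrite edge_sym.
have neq_uv : (u == v) = false.
  by apply/eqP => eq_uv; rewrite eq_uv edge_irr in uv.
have neq_vu : (v == u) = false by rewrite eq_sym.
rewrite /= /pivot_rel /pivot_toggled /between !inE.
rewrite !eqxx !edge_irr uv vu neq_uv neq_vu /=.
have [->|iu] := eqVneq i u; last have [->|iv] := eqVneq i v.
all: have [->|ju] := eqVneq j u; last have [->|jv] := eqVneq j v.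
all: rewrite ?eqxx ?edge_irr ?uv ?vu ?neq_uv ?neq_vu /=.
(* Adjacencies to [u] and [v] are all written with [u] or [v] first, so that each of the nine cases
   becomes a truth table. *)
all: rewrite ?[G i u]edge_sym ?[G i v]edge_sym
  ?[u == j]eq_sym ?[v == j]eq_sym ?(negPf ju) ?(negPf jv) //=.
all: try by case: (G u i); case: (G v i); rewrite ?andbF.
all: try by case: (G u j); case: (G v j).
by case: (G u i); case: (G v i); case: (G u j); case: (G v j); case: (G i j).
Qed.

Lemma mixed_pivot (T : finType) (G : sgraph T) (u v : T) (Y : {set T}) (i j : T) :
  G u v ->
  \sum_k mixed (pivot G u v) Y i k * mixed G [set u; v] k j
    = mixed G (symdiff [set u; v] Y) i j.
Proof.
move=> uv; rewrite {3}/mixed in_symdiff.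
have [iY|iNY] := boolP (i \in Y); last first.
  (* Outside [Y], row [i] of the left factor is a unit row and picks out row [i] of $G_X$. *)
  rewrite (bigD1 i) //= big1 => [|k ki].
    by rewrite {1}/mixed (negPf iNY) eqxx mul1r addr0 addbF.
  by rewrite {1}/mixed (negPf iNY) eq_sym (negPf ki) mul0r.
have neq_vu : v != u.
  by apply/eqP => eq_vu; rewrite eq_vu edge_irr in uv.
rewrite addbT if_neg -(pivot_exchange i j uv) !F2_addb !F2_andb.
(* For $k \notin X$, row [k] of $G_X$ is a unit row, so only $k = j$ can still contribute, and only
   if $j \notin X$. *)
rewrite (bigD1 u) //= (bigD1 v) //= addrA.
rewrite /mixed iY !inE !eqxx orbT; congr (_ + _).
have [jX|jNX] := boolP (j \in [set u; v]).
  rewrite big1 => [|k /andP[ku kv]].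
    by move: jX; rewrite !inE => ->; rewrite mul0r.
  rewrite !inE (negPf ku) (negPf kv) /=; case: eqP => [kj|_]; last by rewrite mulr0.
  by move: jX; rewrite !inE -kj (negPf ku) (negPf kv).
move: jNX; rewrite !inE negb_or => /andP[ju jv].
rewrite (bigD1 j) /= ?ju ?jv // big1 => [|k /andP[/andP[ku kv] kj]].
  by rewrite !inE (negPf ju) (negPf jv) /= eqxx mulr1 mul1r addr0.
by rewrite !inE (negPf ku) (negPf kv) (negPf kj) mulr0.
Qed.

Lemma symdiffA (T : finType) : associative (@symdiff T).
Proof. by move=> A B C; apply/setP => x; rewrite !in_symdiff addbA. Qed.

Lemma symdiffC (T : finType) : commutative (@symdiff T).
Proof. by move=> A B; apply/setP => x; rewrite !in_symdiff addbC. Qed.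

Lemma symdiff0s (T : finType) : left_id set0 (@symdiff T).
Proof. by move=> A; apply/setP => x; rewrite !in_symdiff !inE. Qed.

Lemma symdiffss (T : finType) (A : {set T}) : symdiff A A = set0.
Proof. by apply/setP => x; rewrite in_symdiff addbb inE. Qed.

Lemma fdet_mixed0 (T : finType) (G : rel T) : fdet (mixed G set0) = 1.
Proof.
rewrite -(fdet1 _ T); apply: eq_fdet => i j.
by rewrite /mixed inE.
Qed.

Lemma F2_eq1 (a : 'F_2) : a != 0 -> a = 1.
Proof. by case: a => [[|[|]]] //= lt_a _; apply: val_inj. Qed.

Lemma gdet_pivot (T : finType) (G : sgraph T) (u v : T) (Y : {set T}) :
  G u v ->
  gdet (induced (pivot G u v) Y) = gdet (induced G (symdiff [set u; v] Y)).
Proof.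
move=> uv; rewrite !gdet_induced.
have det_pivot Z : fdet (mixed (pivot G u v) Z) * fdet (mixed G [set u; v]) =
    fdet (mixed G (symdiff [set u; v] Z)).
  by rewrite fdetM; apply: eq_fdet => i j; rewrite mixed_pivot.
have detX : fdet (mixed G [set u; v]) = 1.
  apply: F2_eq1; apply/eqP => det0; have := det_pivot [set u; v].
  by rewrite det0 symdiffss fdet_mixed0 mulr0 => /esym/eqP; rewrite oner_eq0.
by rewrite -det_pivot detX mulr1.
Qed.

Lemma gdet_pivots (T : finType) (G : sgraph T) (phi : seq (T * T)) (Y : {set T}) :
  applicable G phi ->
  gdet (induced (pivots G phi) Y) = gdet (induced G (symdiff (supp phi) Y)).
Proof.
elim: phi G => [|[u v] phi IHphi] G /=; first by rewrite /supp big_nil symdiff0s.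
case/andP => uv happ; rewrite [LHS]IHphi // gdet_pivot //.
rewrite /supp big_cons /= !symdiffA; congr (gdet (induced _ (symdiff (symdiff _ _) _))).
(* As [G] has no loops, [u] and [v] are distinct, whence $\{u\} \oplus \{v\} = \{u,v\}$. *)
have neq_uv : u != v by apply/eqP => eq_uv; rewrite eq_uv edge_irr in uv.
apply/setP => x; rewrite in_symdiff !inE.
by have [->|] := eqVneq x u; rewrite ?(negPf neq_uv).
Qed.

Lemma gdet_pair (T : finType) (G : sgraph T) (x y : T) :
  G x y <-> gdet (induced G [set x; y]) = 1.
Proof.
split=> [xy|].
  (* Pivoting on the edge [xy] itself, with $Y = \emptyset$, equates the determinant with that of
     the empty matrix. *)
  have := gdet_pivot set0 xy; rewrite symdiffC symdiff0s => <-.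
  by rewrite gdet_induced fdet_mixed0.
apply: contra_eqT => /negPf Nxy.
have xX : x \in [set x; y] by rewrite !inE eqxx.
(* Without the edge, the row of [x] vanishes. *)
rewrite /gdet (expand_det_row _ (enum_rank (exist (fun z => z \in [set x; y]) x xX))).
rewrite big1 1?eq_sym ?oner_eq0 // => j _; rewrite mxE enum_rankK.
rewrite /= /induced_rel /=.
have := valP (enum_val j); rewrite !inE => /orP[] /eqP ->.
  by rewrite edge_irr mul0r.
by rewrite Nxy mul0r.
Qed.

Theorem theorem2 (T : finType) (G : sgraph T) (phi : seq (T * T))
    (happ : applicable G phi) (x y : T) (hxy : x <> y) :
  gdet (induced (pivots G phi) [set x; y])
    = gdet (induced G (symdiff (supp phi) [set x; y]))
  /\ (pivots G phi x y
      <-> gdet (induced G (symdiff (supp phi) [set x; y])) = 1%R).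
Proof.
(* Once both determinants are those of [pivots G phi], the equivalence is [gdet_pair] for that
   graph. *)
by rewrite -gdet_pivots //; split=> //; apply: gdet_pair.
Qed.
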